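(* Let $G$ be a $2$-group of order $2^n$ for some positive integer $n\notin\{1,5,7\}$. Then $\operatorname{rdim}(G)=f_2(n)$ if and only if one of the following holds: (i) $n$ is odd, $Z(G)$ is elementary abelian of order $8$, and all characters in $\operatorname{Irr}(G|Z(G))$ are fully ramified with respect to $G/Z(G)$; (ii) $n$ is even, $Z(G)$ is elementary abelian of order either $4$ or $16$, and all characters in $\operatorname{Irr}(G|Z(G))$ are fully ramified with respect to $G/Z(G)$.
   Context: For a finite group $G$, $\operatorname{rdim}(G)$ is the smallest integer $m$ such that $G$ embeds into $\operatorname{GL}(m,\mathbb{C})$. For a prime $p$ and a positive integer $n$, $f_p(n)=\max_{r\in\mathbb{N}}\left(r\,p^{\lfloor (n-r)/2\rfloor}\right)$. $Z(G)$ is the center of $G$. $\operatorname{Irr}(G)$ is the set of irreducible complex characters of $G$; $\operatorname{Irr}(G|Z(G))$ is the set of those $\chi\in\operatorname{Irr}(G)$ that lie over a nonprincipal linear character of $Z(G)$ (equivalently, $Z(G)\not\leq\operatorname{Ker}\chi$). If $N\trianglelefteq G$, $\chi\in\operatorname{Irr}(G)$ and $\theta\in\operatorname{Irr}(N)$ is a constituent of $\chi_N$, then $\chi$ is fully ramified with respect to $G/N$ if $\chi_N=e\theta$ with $e^2=|G:N|$ (so for $N=Z(G)$ this means $\chi(1)^2=|G:Z(G)|$). *)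

(* Defs.v *)
From HB Require Import structures.
From mathcomp Require Import all_boot all_order all_algebra all_fingroup.
From mathcomp Require Import all_solvable all_field all_character.
From mathcomp Require boolp.
From mathcomp Require Import lra zify.

Set Implicit Arguments.
Unset Strict Implicit.
Unset Printing Implicit Defensive.

Import Order.TTheory GRing.Theory Num.Theory.
Local Open Scope ring_scope.

(* A faithful representation of degree m is an embedding of G in GL(m, algC);
   algC plays the role of the complex field, as it does for 'CF(G) and irr G. *)
Definition embeds_in_GL (gT : finGroupType) (G : {group gT}) (m : nat) : Prop :=
  exists rG : mx_representation algC G m, mx_faithful rG.

Lemma embeds_in_GL_ex (gT : finGroupType) (G : {group gT}) :
  exists m, boolp.asbool (embeds_in_GL G m).
Proof.
exists #|G|; apply/boolp.asboolP.
by exists (regular_repr algC G); apply: regular_mx_faithful.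
Qed.

Definition rdim (gT : finGroupType) (G : {group gT}) : nat :=
  ex_minn (embeds_in_GL_ex G).

Lemma rdimP (gT : finGroupType) (G : {group gT}) :
  embeds_in_GL G (rdim G) /\ (forall m, embeds_in_GL G m -> (rdim G <= m)%N).
Proof.
rewrite /rdim; case: ex_minnP => m /boolp.asboolP Gm min_m.
by split=> // k Gk; apply: min_m; apply/boolp.asboolP.
Qed.

(* The maximum of r * p ^ floor((n - r) / 2), taken over r <= n so that the
   exponent is a natural number.  For r > n the floor is negative; by f_maxP
   below, these values of r do not affect the maximum (p, n >= 2). *)
Definition f_max (p n : nat) : nat := \max_(r < n.+1) (r * p ^ (n - r)./2)%N.

Definition f_term (p n r : nat) : rat :=
  r%:R * p%:R ^ ((n%:Z - r%:Z) %/ 2)%Z.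

Lemma f_term_le (p n r : nat) : (r <= n)%N ->
  f_term p n r = (r * p ^ (n - r)./2)%:R.
Proof.
move=> le_rn; rewrite /f_term subzn // divz_nat divn2 natrM natrX.
by rewrite -exprnP.
Qed.

Lemma f_maxP (p n : nat) : (1 < p)%N -> (1 < n)%N ->
  (exists r, f_term p n r = (f_max p n)%:R) /\
  (forall r, f_term p n r <= (f_max p n)%:R).
Proof.
move=> p1 n1; have le_max r : (r <= n)%N -> f_term p n r <= (f_max p n)%:R.
  move=> le_rn; rewrite f_term_le // ler_nat.
  by apply: (leq_bigmax (Ordinal (le_rn : (r < n.+1)%N))).
split.
  have [i def_i] : {i : 'I_n.+1 | f_max p n = (i * p ^ (n - i)./2)%N}.
    by apply: bigop.eq_bigmax; rewrite card_ord.
  by exists i; rewrite f_term_le -1?ltnS // def_i.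
move=> r; have [/le_max//|lt_nr] := leqP r n.
apply: le_trans (le_max n (leqnn n)).
rewrite (f_term_le p (leqnn n)) subnn expn0 muln1.
have p0 : 0 < p%:R :> rat by rewrite ltr0n; lia.
set k := uphalf (r - n).
have -> : f_term p n r = r%:R / p%:R ^+ k.
  rewrite /f_term; have -> : ((n%:Z - r%:Z) %/ 2)%Z = - k%:Z by rewrite /k; lia.
  by rewrite -exprnN.
rewrite ler_pdivrMr ?exprn_gt0 // -natrX -natrM ler_nat.
have k0 : (0 < k)%N by rewrite /k; lia.
have lek : (k < p ^ k)%N by apply: ltn_expl.
have : (r <= n + k.*2)%N by rewrite /k; lia.
by nia.
Qed.

(* Irr(G | Z(G)) *)
Definition Irr_over_center (gT : finGroupType) (G : {group gT}) : {set Iirr G} :=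
  [set i : Iirr G | [exists j : Iirr 'Z(G),
     [&& 'chi_j \is a linear_char, j != 0
       & j \in irr_constt ('Res['Z(G)] 'chi_i)]]].

(* To be used with N <| G. *)
Definition fully_ramified (gT : finGroupType) (G N : {group gT}) (i : Iirr G) :
    Prop :=
  exists2 j : Iirr N, j \in irr_constt ('Res[N] 'chi_i) &
  exists2 e : nat, 'Res[N] 'chi_i = e%:R *: 'chi_j & (e ^ 2)%N = #|G : N|%g.

(* Main.v *)
(* Let |Z(G)| = p^z and |'Ohm_1(Z(G))| = p^r.  All irreducible degrees are at
   most d = p^((n - z)./2), and a normal subgroup of the p-group G is trivial as
   soon as it meets 'Ohm_1(Z(G)) trivially, so a faithful character can be built
   from r irreducible ones, and rdim G <= r * d.  If one irreducible character
   nontrivial on 'Ohm_1(Z(G)) had degree below d, starting from it would make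
   the inequality strict.  Conversely each irreducible character restricts to
   a multiple of a linear character on Z(G), so if Z(G) is elementary abelian
   then a faithful character has at least r constituents nontrivial on Z(G).
   For p = 2, r * 2^((n - z)./2) reaches f_max 2 n only when r = z is 3 (n odd)
   or 2 or 4 (n even). *)
Require Import Defs.
From mathcomp Require Import all_boot all_order all_algebra all_fingroup.
From mathcomp Require Import all_solvable all_field all_character.
From mathcomp Require Import zify.

Set Implicit Arguments.
Unset Strict Implicit.
Unset Printing Implicit Defensive.

Import Order.TTheory GRing.Theory Num.Theory.

(** * Arithmetic of [f_max 2 n] and where it is attained *)

Lemma f_max_ge (p n r : nat) : r <= n -> r * p ^ (n - r)./2 <= f_max p n.
Proof. by move=> le_rn; apply: (leq_bigmax (Ordinal (le_rn : r < n.+1))). Qed.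

Lemma f_max_le (p n m : nat) :
  (forall r, r <= n -> r * p ^ (n - r)./2 <= m) -> f_max p n <= m.
Proof. by move=> le_m; apply/bigmax_leqP=> r _; apply: le_m; rewrite -ltnS. Qed.

Lemma leqif_double_exp2 (k : nat) :
  k.*2 <= 2 ^ k ?= iff ((k == 1) || (k == 2)).
Proof.
apply/leqifP; case: k => [|[|[|k]]] //=.
elim: k => [|k IHk] //; rewrite expnS; lia.
Qed.

(** For [r = k.*2.+1] and [n = m.*2.+3] this is twice the comparison of [r * 2 ^ (m.+1 - k)] with
    [3 * 2 ^ m], after cancelling [2 ^ (m.+1 - k)]; doubling avoids halves. *)
Lemma leqif_double_succ_exp2 (k : nat) :
  2 * k.*2.+1 <= 3 * 2 ^ k ?= iff (k == 1).
Proof.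
apply/leqifP; case: k => [|[|k]] //=.
elim: k => [|k IHk] //; rewrite expnS; lia.
Qed.

Lemma leqif_pmul2r (w m n : nat) (C : bool) :
  0 < w -> m <= n ?= iff C -> m * w <= n * w ?= iff C.
Proof. by move=> w_gt0 [le_mn eq_mn]; split; rewrite ?leq_pmul2r ?eqn_pmul2r. Qed.

(** Both [r = k.*2] and [r = k.*2.+1] give the exponent [m.+1 - k]. Even [r] stay below [2 * 2 ^ m],
    so equality can only come from odd [r]. *)
Lemma f_term2_odd (m r : nat) : r <= m.*2.+3 ->
  r * 2 ^ (m.*2.+3 - r)./2 <= 3 * 2 ^ m ?= iff (r == 3).
Proof.
move=> le_r; have m_gt0 := expn_gt0 2 m.
have def_m k : k <= m.+1 -> 2 * 2 ^ m = 2 ^ k * 2 ^ (m.+1 - k).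
  by move=> le_k; rewrite -expnS -expnD subnKC.
have w_gt0 k := expn_gt0 2 (m.+1 - k).
have [k [def_r | def_r]]: exists k, r = k.*2 \/ r = k.*2.+1 by exists r./2; lia.
  have le_k : k <= m.+1 by lia.
  have -> : (m.*2.+3 - r)./2 = m.+1 - k by lia.
  have [] := leqif_pmul2r (w_gt0 k) (leqif_double_exp2 k).
  rewrite -(def_m k le_k) -def_r => le_u _.
  by apply/leqifP; rewrite ifN; [apply: leq_ltn_trans le_u _ |]; lia.
have le_k : k <= m.+1 by lia.
have -> : (m.*2.+3 - r)./2 = m.+1 - k by lia.
have -> : (r == 3) = (k == 1) by lia.
have := leqif_pmul2r (w_gt0 k) (leqif_double_succ_exp2 k).
rewrite -!mulnA -(def_m k le_k) -def_r; set u := r * _.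
by move/leqifP=> le_u; apply/leqifP; move: le_u; case: ifP => _; lia.
Qed.

Lemma f_term2_even (m r : nat) : r <= m.*2 ->
  r * 2 ^ (m.*2 - r)./2 <= 2 ^ m ?= iff ((r == 2) || (r == 4)).
Proof.
move=> le_r.
have def_m k : k <= m -> 2 ^ m = 2 ^ k * 2 ^ (m - k).
  by move=> le_k; rewrite -expnD subnKC.
have w_gt0 k := expn_gt0 2 (m - k).
have [k [def_r | def_r]]: exists k, r = k.*2 \/ r = k.*2.+1 by exists r./2; lia.
  have le_k : k <= m by lia.
  have -> : (m.*2 - r)./2 = m - k by lia.
  have -> : (r == 2) || (r == 4) = ((k == 1) || (k == 2)) by lia.
  rewrite def_r (def_m k le_k); apply: leqif_pmul2r (w_gt0 k) _.
  exact: leqif_double_exp2.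
(* For odd [r], the values [r] and [r.+1] share one exponent, so the bound for [r.+1] is strict for
   [r]. *)
have le_k : k.+1 <= m by lia.
have -> : (m.*2 - r)./2 = m - k.+1 by lia.
have [le_u _] := leqif_double_exp2 k.+1.
apply/leqifP; rewrite ifN; last lia.
by rewrite (def_m _ le_k) ltn_pmul2r ?w_gt0 //; lia.
Qed.

Lemma f_max2_odd (m : nat) : f_max 2 m.*2.+3 = 3 * 2 ^ m.
Proof.
apply/eqP; rewrite eqn_leq f_max_le /= => [|r le_r]; last exact: f_term2_odd.
by have:= @f_max_ge 2 m.*2.+3 3 isT; rewrite !subSS subn0 doubleK.
Qed.

Lemma f_max2_even (m : nat) : 0 < m -> f_max 2 m.*2 = 2 ^ m.
Proof.
case: m => // m _; apply/eqP.
rewrite eqn_leq f_max_le /= => [|r le_r]; last exact: f_term2_even.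
by have:= @f_max_ge 2 m.+1.*2 2 isT; rewrite doubleS !subSS subn0 doubleK -expnS.
Qed.

(** As [r <= z], the right-hand side is at most [r * 2 ^ (n - r)./2], itself at most [f_max 2 n], so
    equality holds throughout. This fixes [r] and gives [(n - z)./2 = (n - r)./2]; since [n - r] is
    then even, [z = r]. *)
Lemma f_max2_le_rank (n r z : nat) : 1 < n -> r <= z <= n ->
  f_max 2 n <= r * 2 ^ (n - z)./2 ->
  r = z /\ (odd n /\ z = 3 \/ ~~ odd n /\ (z = 2 \/ z = 4)).
Proof.
move=> n_gt1 /andP[le_rz le_zn].
have le_w : 2 ^ (n - z)./2 <= 2 ^ (n - r)./2 by rewrite leq_exp2l //; lia.
have eq_w : 0 < r -> r * 2 ^ (n - r)./2 <= r * 2 ^ (n - z)./2 ->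
    (n - r)./2 = (n - z)./2.
  by move=> r_gt0; rewrite leq_pmul2l // leq_exp2l //; lia.
have le_rn : r <= n by lia.
move: (leq_mul (leqnn r) le_w) => le_rw.
have [m [def_n | def_n]] : exists m, n = m.*2.+3 \/ n = m.*2.
- by case: (boolP (odd n)) => odd_n; [exists (n - 3)./2 | exists n./2]; lia.
- have := @f_term2_odd m r; rewrite -def_n => /(_ le_rn) [le_f eq_f].
  rewrite {1}def_n f_max2_odd => le_max.
  have r3 : r == 3 by rewrite -eq_f; lia.
  by have := eq_w; lia.
have := @f_term2_even m r; rewrite -def_n => /(_ le_rn) [le_f eq_f].
rewrite {1}def_n f_max2_even => [le_max|]; last lia.
have r24 : (r == 2) || (r == 4) by rewrite -eq_f; lia.
by have := eq_w; lia.
Qed.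

(** * Faithful characters and the upper bound on [rdim] *)

Section Rdim.

Local Open Scope group_scope.
Local Open Scope ring_scope.

Variables (gT : finGroupType) (G : {group gT}).

Lemma rdim_le_faithful (chi : 'CF(G)) :
  chi \is a character -> cfaithful chi -> (rdim G)%:R <= chi 1%g.
Proof.
case/char_reprP=> -[m rG] /= ->; rewrite /cfaithful cfker_repr => fful_rG.
by rewrite cfRepr1 ler_nat; apply: (rdimP G).2; exists rG.
Qed.

Lemma rdim_faithful :
  exists chi : 'CF(G), [/\ chi \is a character, cfaithful chi
                         & chi 1%g = (rdim G)%:R].
Proof.
have [[rG fful_rG] _] := rdimP G; exists (cfRepr rG).
by rewrite cfRepr_char /cfaithful cfker_repr cfRepr1.
Qed.

(** Multiplicities are nonnegative, so no constituent cancels in the sum, and the kernel of a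
    character lies in that of each constituent. *)
Lemma cfker_add_irr (chi : 'CF(G)) (i : Iirr G) : chi \is a character ->
  cfker (chi + 'chi_i) \subset cfker chi :&: cfker 'chi_i.
Proof.
move=> Nchi; have Nsum: chi + 'chi_i \is a character.
  by rewrite rpredD ?irr_char.
have sum_neq0 j : (j \in irr_constt chi) || (j == i) ->
  j \in irr_constt (chi + 'chi_i).
  rewrite !irr_consttE cfdotDl cfdot_irr paddr_eq0 ?ler0n //; last first.
    by rewrite natr_ge0 ?Cnat_cfdot_char_irr.
  by rewrite negb_and pnatr_eq0 eqb0 negbK [i == j]eq_sym.
rewrite subsetI (cfker_constt Nsum) ?sum_neq0 ?eqxx ?orbT // andbT.
rewrite (cfkerE Nchi) subsetI cfker_sub /=; apply/bigcapsP=> j Cj.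
by rewrite (cfker_constt Nsum) ?sum_neq0 ?Cj.
Qed.

Lemma exists_irr_notin_cfker x :
  x != 1%g -> exists i : Iirr G, x \notin cfker 'chi_i.
Proof.
move=> ntx; apply/existsP; apply: contraR ntx; rewrite negb_exists => /forallP Kx.
apply/eqP/set1gP; rewrite -(TI_cfker_irr G); apply/bigcapP=> i _.
by have:= Kx i; rewrite negbK.
Qed.

(* Each step adds an irreducible character nontrivial on the part of A that is
   still in the kernel, so the order of that part drops by a factor p. *)
Lemma trivial_cfker_extension (p k : nat) (A : {group gT}) (chi : 'CF(G))
    (d : algC) :
  p.-group A -> chi \is a character ->
  (forall i : Iirr G, 'chi_i 1%g <= d) -> (logn p #|A :&: cfker chi| <= k)%N ->
  exists psi : 'CF(G), [/\ psi \is a character, A :&: cfker psi = 1%g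
                         & psi 1%g <= chi 1%g + k%:R * d].
Proof.
move=> pA + le_d.
have d_ge0: 0 <= d by rewrite (le_trans _ (le_d 0)) ?char1_ge0 ?irr_char.
have pK (phi : 'CF(G)) : p.-group (A :&: cfker phi).
  exact: pgroupS (subsetIl _ _) pA.
elim: k chi => [|k IHk] chi Nchi leK.
  exists chi; rewrite Nchi mul0r addr0 lexx; split=> //; apply/eqP.
  rewrite trivg_card1 (card_pgroup (pK chi)).
  by move: leK; rewrite leqn0 => /eqP->.
have [K1 | /trivgPn[x Kx ntx]] := eqVneq (A :&: cfker chi) 1%g.
  by exists chi; rewrite lerDl mulr_ge0 ?ler0n.
have [i notKx] := exists_irr_notin_cfker ntx.
have [||psi [Npsi K1 le_psi]] := IHk (chi + 'chi_i).
- by rewrite rpredD ?irr_char.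
- rewrite -ltnS (leq_trans _ leK) // properG_ltn_log ?pK //.
  have sK := cfker_add_irr i Nchi.
  apply/properP; split.
    by rewrite setIS // (subset_trans sK) ?subsetIl.
  exists x => //; apply: contra notKx => /setIP[_ /(subsetP sK)].
  by case/setIP.
exists psi; split=> //; apply: le_trans le_psi _.
rewrite cfunE -addrA lerD2l -[k.+1]add1n natrD mulrDl mul1r lerD2r; exact: le_d.
Qed.

(** The starting character is left free: zero gives the general upper bound, an irreducible one
    gives the refined bound that detects small degrees. *)
Lemma rdim_pgroup_le (p : nat) (chi : 'CF(G)) (d : algC) :
  p.-group G -> chi \is a character -> (forall i : Iirr G, 'chi_i 1%g <= d) ->
  (rdim G)%:R <=
    chi 1%g + (logn p #|'Ohm_1('Z(G))%g :&: cfker chi|)%:R * d.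
Proof.
move=> pG Nchi le_d.
have pZ: p.-group 'Ohm_1('Z(G))%g.
  by rewrite (pgroupS _ pG) // (subset_trans (Ohm_sub _ _)) ?center_sub.
have [psi [Npsi TIpsi]] := trivial_cfker_extension pZ Nchi le_d (leqnn _).
apply: le_trans; apply: rdim_le_faithful => //.
rewrite /cfaithful (TI_center_nil (pgroup_nil pG) (cfker_normal psi)) //.
by rewrite TI_Ohm1 // setIC.
Qed.

(** * Lower bound from central elementary abelian subgroups *)

Lemma center_sub_cfcenter (i : Iirr G) : 'Z(G)%g \subset 'Z('chi_i)%CF.
Proof. by rewrite -cap_cfcenter_irr bigcap_inf. Qed.

(** The quotient of [A] by its part in the kernel embeds in the cyclic group
    ['Z('chi_i)%CF / cfker 'chi_i]; being elementary abelian, it has rank at most 1. *)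
Lemma logn_abelem_cfker_irr (p : nat) (A : {group gT}) (i : Iirr G) :
  p.-abelem A -> A \subset 'Z(G)%g ->
  (logn p #|A| <=
     ~~ (A \subset cfker 'chi_i) + logn p #|A :&: cfker 'chi_i|)%N.
Proof.
move=> abA sAZ; have [/setIidPl-> // | _] := boolP (A \subset _).
have sAG: A \subset G by apply: subset_trans sAZ (center_sub G).
have nKA: A \subset 'N(cfker 'chi_i) by apply: subset_trans sAG (cfker_norm _).
have sAZi: A \subset 'Z('chi_i)%CF.
  exact: subset_trans sAZ (center_sub_cfcenter i).
rewrite -(Lagrange (subsetIl A (cfker 'chi_i))) lognM ?cardG_gt0 ?indexg_gt0 //.
rewrite indexgI -card_quotient // addnC leq_add2r.
rewrite -abelem_cyclic ?quotient_abelem //.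
exact: cyclicS (quotientS _ sAZi) (cfcenter_cyclic _).
Qed.

Lemma logn_abelem_bigcap_cfker (p : nat) (A : {group gT}) (s : seq (Iirr G)) :
  p.-abelem A -> A \subset 'Z(G)%g ->
  (logn p #|A| <= count (fun i => ~~ (A \subset cfker 'chi_i)) s
                  + logn p #|A :&: \bigcap_(i <- s) cfker 'chi_i|)%N.
Proof.
elim: s A => [|i s IHs] A abA sAZ; first by rewrite big_nil setIT.
have sKA := subsetIl A (cfker 'chi_i).
(* Induction passes to [A :&: cfker 'chi_i]; characters trivial on [A] stay trivial there, so the
   count can only drop. *)
have:= IHs _ (abelemS sKA abA) (subset_trans sKA sAZ).
rewrite big_cons setIA /= -addnA => leK.
apply: leq_trans (logn_abelem_cfker_irr i abA sAZ) _; rewrite leq_add2l.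
apply: leq_trans leK _; rewrite leq_add2r sub_count // => j /=.
by apply: contra; apply: subset_trans.
Qed.

(** Each constituent kernel lowers the rank of [A] by at most 1, so at least [logn p #|A|]
    constituents are nontrivial on [A], each contributing at least [d]. *)
Lemma char1_ge_logn (p : nat) (A : {group gT}) (chi : 'CF(G)) (d : algC) :
  0 <= d -> p.-abelem A -> A \subset 'Z(G)%g -> chi \is a character ->
  A :&: cfker chi = 1%g ->
  (forall i : Iirr G, ~~ (A \subset cfker 'chi_i) -> d <= 'chi_i 1%g) ->
  (logn p #|A|)%:R * d <= chi 1%g.
Proof.
move=> d_ge0 abA sAZ Nchi K1 ge_d.
have sAG: A \subset G by apply: subset_trans sAZ (center_sub G).
pose P := [pred i in irr_constt chi | ~~ (A \subset cfker 'chi_i)].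
have le_P: (logn p #|A| <= #|P|)%N.
  have:= logn_abelem_bigcap_cfker (enum (irr_constt chi)) abA sAZ.
  (* [A] is written as [A :&: G] because [cfkerE] presents the kernel as [G] intersected with the
     constituent kernels. *)
  rewrite big_enum /= -[A in A :&: \bigcap_(_ in _) _](setIidPl sAG) -setIA.
  rewrite -cfkerE // K1 cards1 logn1 addn0 => /leq_trans-> //.
  rewrite cardE -size_filter -filter_predI.
  by rewrite (eq_filter (a2 := P)) // => i; rewrite /= andbC.
have chi1: (chi 1%g = \sum_(i in irr_constt chi) '[chi, 'chi_i] * 'chi_i 1%g).
  by rewrite {1}[chi]cfun_sum_constt sum_cfunE; apply: eq_bigr => i; rewrite cfunE.
have term_ge0 i : 0 <= '[chi, 'chi_i] * 'chi_i 1%g.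
  by rewrite mulr_ge0 ?char1_ge0 ?irr_char ?natr_ge0 ?Cnat_cfdot_char_irr.
rewrite chi1 (bigID (fun i => ~~ (A \subset cfker 'chi_i))) /=.
rewrite -[X in X <= _]addr0 lerD ?sumr_ge0 //.
apply: (@le_trans _ _ (#|P|%:R * d)); first by rewrite ler_wpM2r // ler_nat.
rewrite mulr_natl -sumr_const; apply: ler_sum => i /andP[Ci ntAi].
(* The multiplicity of a constituent is a nonzero natural number, hence at least 1. *)
apply: le_trans (ge_d i ntAi) _; rewrite ler_peMl ?char1_ge0 ?irr_char //.
have /natrP[k def_k] := Cnat_cfdot_char_irr i Nchi.
by move: Ci; rewrite irr_consttE def_k pnatr_eq0 ler1n lt0n.
Qed.

(** * Degrees and restriction to the centre in p-groups *)

Lemma card_index_center (p n z : nat) :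
  prime p -> #|G| = (p ^ n)%N -> #|'Z(G)| = (p ^ z)%N ->
  #|G : 'Z(G)|%g = (p ^ (n - z))%N.
Proof.
move=> p_pr oG oZ; rewrite -divgS ?center_sub // oG oZ expnB ?prime_gt0 //.
rewrite -(leq_exp2l _ _ (prime_gt1 p_pr)) -oG -oZ subset_leq_card //.
exact: center_sub.
Qed.

(** The degree divides [#|G|], hence is a power of [p], and its square is at most the index of
    ['Z('chi_i)%CF], which contains ['Z(G)]. *)
Lemma irr1_pgroup (p n z : nat) (i : Iirr G) :
  prime p -> #|G| = (p ^ n)%N -> #|'Z(G)| = (p ^ z)%N ->
  exists2 a, (a.*2 <= n - z)%N & 'chi_i 1%g = (p ^ a)%N%:R.
Proof.
move=> p_pr oG oZ; have:= dvd_irr1_cardG i; have:= irr1_bound i.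
rewrite irr1_degree; set d := irr_degree _ => -[le_d _].
rewrite oG dvdC_nat => /(dvdn_pfactor _ _ p_pr)[a _ def_d].
exists a; last by rewrite def_d.
rewrite -(leq_exp2l _ _ (prime_gt1 p_pr)) -muln2 expnM -def_d.
rewrite -(card_index_center p_pr oG oZ).
rewrite -(ler_nat algC) natrX; apply: le_trans le_d _.
by rewrite ler_nat dvdn_leq // indexgS // center_sub_cfcenter.
Qed.

Lemma irr1_pgroup_le (p n z : nat) (i : Iirr G) :
  prime p -> #|G| = (p ^ n)%N -> #|'Z(G)| = (p ^ z)%N ->
  'chi_i 1%g <= (p ^ (n - z)./2)%N%:R.
Proof.
move=> p_pr oG oZ; have [a le_a ->] := irr1_pgroup i p_pr oG oZ.
by rewrite ler_nat leq_exp2l ?prime_gt1 // geq_half_double.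
Qed.

Lemma Res_center_irr (i : Iirr G) :
  exists2 j : Iirr 'Z(G)%g, 'chi_j \is a linear_char
    & 'Res['Z(G)%g] 'chi_i = 'chi_i 1%g *: 'chi_j.
Proof.
have sZ := center_sub_cfcenter i.
have [xi Lxi defRes] := cfcenter_Res 'chi_i.
have /irrP[j def_j]: 'Res['Z(G)%g] xi \in irr 'Z(G)%g.
  by rewrite lin_char_irr ?cfRes_lin_char.
exists j; first by rewrite -def_j cfRes_lin_char.
by rewrite -(cfResRes _ sZ) ?cfcenter_sub // defRes linearZ /= def_j.
Qed.

(** Restriction to the centre is always a multiple of a linear character, so the ramification index
    [e] is the degree. *)
Lemma fully_ramified_centerE (i : Iirr G) :
  fully_ramified 'Z(G)%g i <-> 'chi_i 1%g ^+ 2 = #|G : 'Z(G)|%g%:R.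
Proof.
have [j Lj def_i] := Res_center_irr i; split=> [[k _ [e def_e <-]] | chi2].
  have Lk: 'chi_k \is a linear_char.
    by apply/char_abelianP; rewrite center_abelian.
  suff -> : 'chi_i 1%g = e%:R by rewrite natrX.
  by rewrite -(cfRes1 'Z(G)%g) def_e cfunE lin_char1 ?mulr1.
exists j.
  by rewrite irr_consttE def_i cfdotZl cfnorm_irr mulr1 irr1_neq0.
have /natrP[e def_e] := Cnat_irr1 i; exists e; first by rewrite def_i def_e.
by apply/eqP; rewrite -(eqr_nat algC) natrX -def_e chi2.
Qed.

Lemma mem_Irr_over_center (i : Iirr G) :
  (i \in Irr_over_center G) = ~~ ('Z(G)%g \subset cfker 'chi_i).
Proof.
have [j Lj def_i] := Res_center_irr i.
have defC k : (k \in irr_constt ('Res['Z(G)%g] 'chi_i)) = (k == j).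
  rewrite irr_consttE def_i cfdotZl cfdot_irr mulf_eq0 (negPf (irr1_neq0 i)) /=.
  by rewrite pnatr_eq0 eqb0 negbK eq_sym.
have -> : ('Z(G)%g \subset cfker 'chi_i) = (j == 0).
  rewrite -subGcfker -(cfker_scale_nz 'chi_j (irr1_neq0 i)) -def_i.
  by rewrite cfker_Res ?center_sub ?irr_char // subsetI subxx.
rewrite inE; apply/existsP/idP => [[k /and3P[_ ntk]] | ntj].
  by rewrite defC => /eqP<-.
by exists j; rewrite Lj ntj defC /=.
Qed.

Lemma rdim_pgroup_le_Ohm1 (p n z : nat) :
  prime p -> #|G| = (p ^ n)%N -> #|'Z(G)| = (p ^ z)%N ->
  (rdim G <= logn p #|'Ohm_1('Z(G))%g| * p ^ (n - z)./2)%N.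
Proof.
move=> p_pr oG oZ; rewrite -(ler_nat algC) natrM.
have pG: p.-group G by rewrite /pgroup oG pnatX pnat_id.
have := rdim_pgroup_le pG (cfun0_char G) (fun i => irr1_pgroup_le i p_pr oG oZ).
(* The zero character has kernel [G], so all of ['Ohm_1('Z(G))] counts. *)
rewrite cfunE add0r cfker_cfun0 (setIidPl _) //.
by rewrite (subset_trans (Ohm_sub _ _)) ?center_sub.
Qed.

(** Evenness of [n - z] makes [d = p ^ (n - z)./2] an exact square root of the index, so full
    ramification means degree [d]. *)
Lemma rdim_abelem_center (p n z : nat) :
    prime p -> #|G| = (p ^ n)%N -> p.-abelem 'Z(G)%g ->
    #|'Z(G)| = (p ^ z)%N -> ~~ odd (n - z) ->
  rdim G = (z * p ^ (n - z)./2)%N <->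
  (forall i : Iirr G, i \in Irr_over_center G -> fully_ramified 'Z(G)%g i).
Proof.
move=> p_pr oG abZ oZ even_nz; move def_d: (p ^ (n - z)./2)%N => d.
have pG: p.-group G by rewrite /pgroup oG pnatX pnat_id.
have d2: (d ^ 2)%N = #|G : 'Z(G)|%g.
  by rewrite -def_d (card_index_center p_pr oG oZ) -expnM muln2 even_halfK.
have logZ: logn p #|'Z(G)| = z by rewrite oZ pfactorK.
have le_d i : 'chi[G]_i 1%g <= d%:R by rewrite -def_d; apply: irr1_pgroup_le oZ.
have ramE i : fully_ramified 'Z(G)%g i <-> 'chi[G]_i 1%g = d%:R.
  rewrite fully_ramified_centerE -d2 natrX.
  split=> [/eqP | ->] //; rewrite eqrXn2 ?ler0n ?char1_ge0 ?irr_char //.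
  by move/eqP.
split=> [def_rdim i | ram].
  rewrite mem_Irr_over_center => ntZi; apply/ramE/eqP.
  rewrite eq_le le_d /=.
  (* Starting from ['chi_i], at most [z - 1] further constituents are needed; [rdim G = z * d] then
     forces ['chi_i] to have degree at least [d]. *)
  have ltK: (logn p #|'Z(G)%g :&: cfker 'chi_i| < z)%N.
    rewrite -logZ properG_ltn_log ?abelem_pgroup // properE subsetIl subsetI.
    by rewrite subxx.
  rewrite -(lerD2r ((logn p #|'Z(G)%g :&: cfker 'chi_i|)%:R * d%:R)).
  have:= rdim_pgroup_le pG (irr_char i) le_d; rewrite (Ohm1_id abZ).
  apply: le_trans; rewrite def_rdim natrM -[X in X + _]mul1r -mulrDl nat1r.
  by rewrite ler_wpM2r ?ler0n // ler_nat.
apply/eqP; rewrite eqn_leq -{1}logZ -{1}(Ohm1_id abZ) -{1}def_d.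
rewrite rdim_pgroup_le_Ohm1 //=.
have [chi [Nchi fful_chi chi1]] := rdim_faithful.
rewrite -(ler_nat algC) -chi1 natrM -logZ.
apply: char1_ge_logn => // [|i]; first exact/trivgP/(subset_trans (subsetIr _ _)).
by rewrite -mem_Irr_over_center => /ram/ramE->.
Qed.

End Rdim.

Local Open Scope group_scope.

Theorem theoremC (gT : finGroupType) (G : {group gT}) (n : nat)
    (n_gt0 : (0 < n)%N) (n_neq : n \notin [:: 1; 5; 7]%N)
    (oG : #|G| = (2 ^ n)%N) :
  rdim G = f_max 2 n <->
  [/\ odd n, 2.-abelem 'Z(G), #|'Z(G)| = 8%N &
      forall i : Iirr G, i \in Irr_over_center G -> fully_ramified 'Z(G) i]
  \/
  [/\ ~~ odd n, 2.-abelem 'Z(G), #|'Z(G)| = 4%N \/ #|'Z(G)| = 16%N &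
      forall i : Iirr G, i \in Irr_over_center G -> fully_ramified 'Z(G) i].
Proof.
have sZG := center_sub G.
have pG : 2.-group G by rewrite /pgroup oG pnatX pnat_id.
have [z oZ] := p_natP (pgroupS sZG pG).
have le_zn : (z <= n)%N by rewrite -(@leq_exp2l 2) // -oG -oZ subset_leq_card.
have ramE := rdim_abelem_center (isT : prime 2) oG _ oZ.
have n_gt1 : (1 < n)%N by move: n_neq; rewrite !inE; lia.
split=> [def_rdim | ].
  set r := logn 2 #|'Ohm_1('Z(G))|.
  have le_rz : (r <= z)%N.
    by rewrite -(pfactorK z (isT : prime 2)) -oZ dvdn_leq_log ?cardSg ?Ohm_sub.
  have := rdim_pgroup_le_Ohm1 (isT : prime 2) oG oZ; rewrite def_rdim.
  case/(f_max2_le_rank n_gt1); first by rewrite le_rz.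
  move=> rz z_cases.
  (* Equal ranks [r = z] give both groups the same order. *)
  have defZ : 'Ohm_1('Z(G)) = 'Z(G).
    apply/eqP; rewrite eqEcard Ohm_sub /= oZ -rz /r -card_pgroup //.
    by rewrite (pgroupS (subset_trans (Ohm_sub _ _) sZG)).
  have abZ : 2.-abelem 'Z(G).
    by rewrite -defZ Ohm1_abelem ?center_abelian ?(pgroupS sZG).
  have even_nz : ~~ odd (n - z) by case: z_cases; lia.
  have ram := (ramE abZ even_nz).1; rewrite def_rdim in ram.
  case: z_cases => [[odd_n z3] | [even_n z24]]; [left | right].
    split; rewrite ?oZ ?z3 //; apply: ram.
    have -> : n = (n - 3)./2.*2.+3 by lia.
    by rewrite f_max2_odd z3 !subSS subn0 doubleK.
  split=> //; first by rewrite oZ; case: z24 => ->; [left | right].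
  apply: ram; have [m def_n] : exists m, n = m.+1.*2 by exists (n./2).-1; lia.
  rewrite def_n f_max2_even //; case: z24 => z_eq.
    by rewrite z_eq doubleS !subSS subn0 doubleK expnS.
  (* A centre of order 16 excludes [n = 2], through [le_zn]. *)
  case: m def_n => [|m] def_n; first lia.
  by rewrite z_eq !doubleS !subSS subn0 doubleK !expnS mulnA.
(* The orders 8, 4 and 16 are read by conversion as powers of 2 with exponents 3, 2 and 4. *)
have log2 k : (2 ^ z = 2 ^ k -> z = k)%N by move/eqP; rewrite eqn_exp2l // => /eqP.
case=> -[odd_n abZ]; rewrite oZ.
  move=> /(log2 3) z3; rewrite z3 in le_zn ramE * => /ramE-> //; last lia.
  have -> : n = (n - 3)./2.*2.+3 by lia.
  by rewrite f_max2_odd !subSS subn0 doubleK.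
have [m def_n] : exists m, n = m.+1.*2 by exists (n./2).-1; lia.
rewrite def_n f_max2_even // => -[/(log2 2) | /(log2 4)] z_eq.
  rewrite z_eq in le_zn ramE * => /ramE-> //; last lia.
  by rewrite def_n doubleS !subSS subn0 doubleK expnS.
rewrite z_eq in le_zn ramE * => /ramE-> //; last lia.
case: m def_n => [|m] def_n; first lia.
by rewrite def_n !doubleS !subSS subn0 doubleK !expnS mulnA.
Qed.
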